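(* Let $P$ be a simple polytope of dimension $3$ and let $\mathbf{c}$ be a generic cost vector such that the directed graph $G(P,\mathbf{c})$ is the Hasse diagram of a lattice $L$. Then $G(P,\mathbf{c})$ has the nonrevisiting property: for every face $F$ of $P$, any directed path in $G(P,\mathbf{c})$ whose first and last vertices both lie in $F$ has all of its vertices in $F$.
   Context: A polytope is simple if for each vertex $v$ and each set of $i$ edges at $v$ there is an $i$-dimensional face containing $v$ and those edges. $\mathbf{c}$ is generic if it takes distinct values on distinct vertices of $P$. $G(P,\mathbf{c})$ is the 1-skeleton of $P$ with each edge oriented from the endpoint with smaller $\mathbf{c}$-value to the one with larger $\mathbf{c}$-value. The Hasse diagram of a finite poset has a directed edge $u\to v$ iff $v$ covers $u$. *)

(* Defs.v *)
From mathcomp Require Import all_boot all_order all_algebra.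
From mathcomp Require Import all_classical all_reals.

Set Implicit Arguments.
Unset Strict Implicit.
Unset Printing Implicit Defensive.

Import Order.TTheory GRing.Theory Num.Theory.
Local Open Scope classical_set_scope.
Local Open Scope card_scope.
Local Open Scope ring_scope.

Definition dotp (R : realType) (n : nat) (u v : 'rV[R]_n) : R :=
  \sum_(i < n) u 0 i * v 0 i.

Definition affine_hull (R : realType) (n : nat) (A : set 'rV[R]_n) :
    set 'rV[R]_n :=
  [set x | exists (m : nat) (p : 'I_m -> 'rV[R]_n) (w : 'I_m -> R),
     [/\ forall i, A (p i), \sum_(i < m) w i = 1
       & x = \sum_(i < m) w i *: p i]].

Definition convex_hull (R : realType) (n : nat) (A : set 'rV[R]_n) :
    set 'rV[R]_n :=
  [set x | exists (m : nat) (p : 'I_m -> 'rV[R]_n) (w : 'I_m -> R),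
     [/\ forall i, A (p i), forall i, 0 <= w i, \sum_(i < m) w i = 1
       & x = \sum_(i < m) w i *: p i]].

(* The affine hull of A is a translate of a k-dimensional linear subspace;
   the empty set therefore has no dimension. *)
Definition has_dim (R : realType) (n : nat) (A : set 'rV[R]_n) (k : nat) :
    Prop :=
  exists (x0 : 'rV[R]_n) (U : {vspace 'rV[R]_n}),
    \dim U = k /\ affine_hull A = [set x0 + u | u in [set` U]].

Definition polytope (R : realType) (n : nat) (P : set 'rV[R]_n) : Prop :=
  exists2 V : set 'rV[R]_n, finite_set V & P = convex_hull V.

(* Faces are cut out by valid linear inequalities; set0 and P itself are
   faces (take a = 0). *)
Definition face (R : realType) (n : nat) (P F : set 'rV[R]_n) : Prop :=
  exists (a : 'rV[R]_n) (b : R),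
    (forall x, P x -> dotp a x <= b) /\ F = [set x | P x /\ dotp a x = b].

Definition vertex (R : realType) (n : nat) (P : set 'rV[R]_n) :
    set 'rV[R]_n := [set v | face P [set v]].

Definition edge (R : realType) (n : nat) (P : set 'rV[R]_n) :
    set (set 'rV[R]_n) := [set E | face P E /\ has_dim E 1].

Definition simple_polytope (R : realType) (n : nat) (P : set 'rV[R]_n) :
    Prop :=
  polytope P /\
  forall (v : 'rV[R]_n) (i : nat) (S : set (set 'rV[R]_n)),
    vertex P v -> S `<=` [set E | edge P E /\ E v] -> S #= `I_i ->
    exists F, [/\ face P F, has_dim F i, F v & forall E, S E -> E `<=` F].

Definition generic (R : realType) (n : nat) (P : set 'rV[R]_n)
    (c : 'rV[R]_n) : Prop :=
  forall u v, vertex P u -> vertex P v -> u <> v -> dotp c u <> dotp c v.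

(* The arc relation of G(P, c), whose vertex set is [vertex P]: the endpoints
   of an edge E are the vertices of P lying on E. *)
Definition skeleton_arc (R : realType) (n : nat) (P : set 'rV[R]_n) (c : 'rV[R]_n)
    (u v : 'rV[R]_n) : Prop :=
  [/\ vertex P u, vertex P v, exists E, [/\ edge P E, E u & E v]
    & dotp c u < dotp c v].

Definition covered_by (d : Order.disp_t) (L : porderType d) (x y : L) : Prop :=
  (x < y)%O /\ forall z : L, ~ ((x < z)%O /\ (z < y)%O).

(* The digraph with vertex set V and arc relation A is, up to naming its
   vertices by the elements of L, the Hasse diagram of L. *)
Definition is_hasse_diagram (T : Type) (V : set T) (A : T -> T -> Prop)
    (d : Order.disp_t) (L : finPOrderType d) : Prop :=
  exists f : L -> T,
    set_bij setT V f /\ forall x y : L, A (f x) (f y) <-> covered_by x y.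

(* The directed path is u :: s. *)
Definition nonrevisiting (R : realType) (n : nat) (P : set 'rV[R]_n)
    (c : 'rV[R]_n) : Prop :=
  forall (F : set 'rV[R]_n) (u : 'rV[R]_n) (s : seq 'rV[R]_n),
    face P F -> path (fun x y => `[< skeleton_arc P c x y >]) u s ->
    F u -> F (last u s) -> forall x, x \in u :: s -> F x.

(* Main.v *)
(* No planarity is needed.  Let F be a 2-face with sink t.  By downward
   induction on u in F, an arc u -> x that leaves F never has x <= t.  Indeed
   let u -> y be an arc of F, G the 2-face spanned by x, u, y (simplicity) and
   w the join of x and y, so that w <= t and w is below the sink of G.  By
   induction all directed paths from x or y to w stay in G.  If w were not the
   sink of G, it would have at most one lower neighbour in G, which would be an
   upper bound of x and y below their join; so w is the sink of G.  Then G has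
   an arc y -> z, it leaves F because F and G cannot share u, y and z, and
   z <= w <= t contradicts the induction hypothesis at y.  Hence 2-faces are
   convex in L; faces of other dimensions are trivial.

   The geometric input is that a vertex of a face which does not maximize c on
   it has an ascending edge in that face, by a parametric simplex argument. *)
Require Import Defs.
From mathcomp Require Import all_boot all_order all_algebra.
From mathcomp Require Import all_classical all_reals.
From mathcomp Require Import lra.

Set Implicit Arguments.
Unset Strict Implicit.
Unset Printing Implicit Defensive.

Import Order.TTheory GRing.Theory Num.Theory.
Local Open Scope classical_set_scope.
Local Open Scope ring_scope.

(** * Induction and covers in finite posets *)

Lemma upward_ind (d : Order.disp_t) (L : finPOrderType d) (Q : L -> Prop) :
  (forall x, (forall y, (x < y)%O -> Q y) -> Q x) -> forall x, Q x.
Proof.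
move=> IH x; have [m] := ubnP #|[pred y : L | (x < y)%O]|.
elim: m x => // m IHm x; rewrite ltnS => le_m; apply: IH => y ltxy.
apply: IHm; apply: leq_trans le_m; apply: proper_card.
apply/fintype.properP; split.
  by apply/fintype.subsetP => z; rewrite !inE; exact: lt_trans.
by exists y; rewrite !inE ?ltxx.
Qed.

(** Among the elements of the interval from x, excluded, to y, take one with the fewest elements
    below it: anything strictly between x and it would have fewer still. *)
Lemma coverW (d : Order.disp_t) (L : finPOrderType d) (x y : L) :
  (x < y)%O -> exists2 z, covered_by x z & (z <= y)%O.
Proof.
move=> ltxy; have Py : [pred z : L | (x < z <= y)%O] y by rewrite /= ltxy /=.
case: (@arg_minnP _ y _ (fun z : L => #|[pred t : L | (t < z)%O]|) Py) => z /=.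
move=> /andP[ltxz lezy] minz.
exists z => //; split=> // t [ltxt lttz].
have := minz t; rewrite ltxt (le_trans (ltW lttz) lezy) => /(_ isT).
apply/negP; rewrite -ltnNge; apply: proper_card; apply/fintype.properP; split.
  by apply/fintype.subsetP => s; rewrite !inE => /lt_trans; apply.
by exists t; rewrite !inE ?ltxx.
Qed.

(** * Order convexity of polygons in an abstract lattice *)

Section PolygonLattice.
Context (R : realType) (d : Order.disp_t) (L : finLatticeType d).
Context (C : L -> R) (polygon : set (set L)).

(** These hypotheses abstract from the geometry: [polygon] stands for the vertex sets of 2-faces and
    [C] for the cost. [polygon_deg] keeps only the case of degree two that occurs at a join.
    [polygon_cap] asks for a directed path because its three vertices cannot be collinear. *)
Hypothesis C_inj : injective C.
Hypothesis C_cover : forall x y, covered_by x y -> C x < C y.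
Hypothesis polygon_up : forall F x y, polygon F -> F x -> F y -> C x < C y ->
  exists2 z, F z & covered_by x z.
Hypothesis polygon_deg : forall F w p q r, polygon F ->
  F w -> F p -> F q -> F r ->
  covered_by p w -> covered_by q w -> covered_by w r -> p = q.
Hypothesis polygon_span : forall u x y, covered_by u x -> covered_by u y ->
  x <> y -> exists2 G, polygon G & [/\ G u, G x & G y].
Hypothesis polygon_cap : forall F G u y z, polygon F -> polygon G ->
  F u -> F y -> F z -> G u -> G y -> G z ->
  covered_by u y -> covered_by y z -> F = G.

Lemma cost_lt x y : (x < y)%O -> C x < C y.
Proof.
elim/upward_ind: x => x IH ltxy; have [z xz lezy] := coverW ltxy.
have [<-|nezy] := eqVneq z y; first exact: C_cover.
by apply: lt_trans (C_cover xz) _; apply: IH; [case: xz|rewrite lt_neqAle nezy].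
Qed.

(** No vertex of F costs more than t, or [polygon_up] would give t an outgoing arc in F. A cheaper
    one has an outgoing arc in F, so the induction climbs to t. Thus a local sink is the greatest
    element of F. *)
Lemma sink_ge F t x : polygon F -> F t ->
  (forall z, F z -> ~ covered_by t z) -> F x -> (x <= t)%O.
Proof.
move=> pF Ft tmax; elim/upward_ind: x => x IH Fx.
have [ltC|ltC|/C_inj->//] := ltgtP (C x) (C t).
  have [z Fz xz] := polygon_up pF Fx Ft ltC.
  by have [ltxz _] := xz; apply: le_trans (ltW ltxz) (IH _ ltxz Fz).
by have [z Fz /(tmax _ Fz)] := polygon_up pF Ft Fx ltC.
Qed.

Lemma sink_exists F x : polygon F -> F x ->
  exists2 t, F t & forall z, F z -> (z <= t)%O.
Proof.
move=> pF; elim/upward_ind: x => x IH Fx.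
have [[z Fz xz]|nz] := pselect (exists2 z, F z & covered_by x z).
  by have [ltxz _] := xz; apply: IH Fz.
exists x => // z; apply: sink_ge => // y Fy xy.
by apply: nz; exists y.
Qed.

(** The polygon, the escaping arc and the sink stay general in the induction: it is applied to the
    spanned polygon G at vertices above u, and to F itself at y. *)
Lemma leave_sink u F x t : polygon F -> F u -> covered_by u x -> ~ F x ->
  F t -> (forall z, F z -> (z <= t)%O) -> ~ (x <= t)%O.
Proof.
elim/upward_ind: u F x t => u IH F x t pF Fu ux nFx Ft tmax lext.
have [ltux nux] := ux.
have [y Fy uy] := polygon_up pF Fu Ft (cost_lt (lt_le_trans ltux lext)).
have [ltuy nuy] := uy.
have nexy : x <> y by move=> exy; apply: nFx; rewrite exy.
have [G pG [Gu Gx Gy]] := polygon_span ux uy nexy.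
have [g Gg gmax] := sink_exists pG Gu.
set w := (x `|` y)%O.
have lewt : (w <= t)%O by rewrite leUx lext tmax.
have lewg : (w <= g)%O by rewrite leUx !gmax.
(* By induction no path from x or y to w leaves G, as it stays below g. *)
have stay z : G z -> (u < z)%O -> (z <= w)%O ->
    G w /\ (z = w \/ exists p, [/\ G p, (z <= p)%O & covered_by p w]).
  elim/upward_ind: z => z IHz Gz ltuz lezw.
  have [<-|nezw] := eqVneq z w; first by split=> //; left.
  have ltzw : (z < w)%O by rewrite lt_neqAle nezw.
  have [z' zz' lez'w] := coverW ltzw.
  have [ltzz' _] := zz'.
  have Gz' : G z'.
    apply: contrapT => nGz'.
    exact: (IH z ltuz G z' g pG Gz zz' nGz' Gg gmax (le_trans lez'w lewg)).
  have [Gw ez'] := IHz z' ltzz' Gz' (lt_trans ltuz ltzz') lez'w.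
  split=> //; right; case: ez' => [<-|[p [Gp lez'p pw]]]; first by exists z.
  by exists p; split=> //; apply: le_trans (ltW ltzz') lez'p.
have [Gw ex] := stay x Gx ltux (leUl _ _).
have [_ ey] := stay y Gy ltuy (leUr _ _).
(* If x were the join, then u < y < x, although x covers u; likewise for y. *)
have ltxw : (x < w)%O.
  rewrite lt_neqAle leUl andbT; apply/eqP => exw.
  apply: (nux y); split=> //; rewrite lt_neqAle {2}exw leUr andbT.
  by apply/eqP => /esym.
have ltyw : (y < w)%O.
  rewrite lt_neqAle leUr andbT; apply/eqP => eyw.
  by apply: (nuy x); split=> //; rewrite lt_neqAle {2}eyw leUl andbT; apply/eqP.
case: ex => [exw|[p [Gp lexp pw]]]; first by rewrite {1}exw ltxx in ltxw.
case: ey => [eyw|[q [Gq leyq qw]]]; first by rewrite {1}eyw ltxx in ltyw.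
have wsink z : G z -> ~ covered_by w z.
  move=> Gz wz; have epq := polygon_deg pG Gw Gp Gq Gz pw qw wz.
  have [ltpw _] := pw; have : (w <= p)%O by rewrite leUx lexp epq.
  by rewrite (lt_geF ltpw).
have [z Gz yz] := polygon_up pG Gy Gw (cost_lt ltyw).
apply: (IH y ltuy F z t pF Fy yz _ Ft tmax).
  by move=> Fz; apply: nFx; rewrite (polygon_cap pF pG Fu Fy Fz).
exact: le_trans (sink_ge pG Gw wsink Gz) lewt.
Qed.

(** Climb from u to x by covers. The first one to leave F would end below x, hence below v and the
    sink of F, which [leave_sink] forbids. *)
Lemma polygon_convex F u x v : polygon F -> F u -> F v ->
  (u <= x)%O -> (x <= v)%O -> F x.
Proof.
move=> pF; elim/upward_ind: u => u IH Fu Fv leux lexv.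
have [<-//|neux] := eqVneq u x.
have [z uz lezx] : exists2 z, covered_by u z & (z <= x)%O.
  by apply: coverW; rewrite lt_neqAle neux.
have [t Ft tmax] := sink_exists pF Fu.
have [ltuz _] := uz; apply: (IH z) => //; apply: contrapT => nFz.
apply: (leave_sink pF Fu uz nFz Ft tmax).
exact: le_trans lezx (le_trans lexv (tmax _ Fv)).
Qed.

End PolygonLattice.

(** * Bilinearity and positivity of the dot product *)

Section Dotp.
Context (R : realType) (n : nat).
Implicit Types u v w : 'rV[R]_n.

Lemma dotpC u v : dotp u v = dotp v u.
Proof. by apply: eq_bigr => i _; rewrite mulrC. Qed.

Lemma dotpDr u v w : dotp u (v + w) = dotp u v + dotp u w.
Proof. by rewrite -big_split; apply: eq_bigr => i _; rewrite mxE mulrDr. Qed.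

Lemma dotpZr k u v : dotp u (k *: v) = k * dotp u v.
Proof. by rewrite mulr_sumr; apply: eq_bigr => i _; rewrite mxE mulrCA. Qed.

Lemma dotpNr u v : dotp u (- v) = - dotp u v.
Proof. by rewrite -scaleN1r dotpZr mulN1r. Qed.

Lemma dotpBr u v w : dotp u (v - w) = dotp u v - dotp u w.
Proof. by rewrite dotpDr dotpNr. Qed.

Lemma dotp0r u : dotp u 0 = 0.
Proof. by rewrite -(scale0r 0) dotpZr mul0r. Qed.

Lemma dotpDl u v w : dotp (v + w) u = dotp v u + dotp w u.
Proof. by rewrite !(dotpC _ u) dotpDr. Qed.

Lemma dotpZl k u v : dotp (k *: v) u = k * dotp v u.
Proof. by rewrite !(dotpC _ u) dotpZr. Qed.

Lemma dotpNl u v : dotp (- v) u = - dotp v u.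
Proof. by rewrite !(dotpC _ u) dotpNr. Qed.

Lemma dotp_sumr (I : Type) (r : seq I) u (F : I -> 'rV[R]_n) :
  dotp u (\sum_(i <- r) F i) = \sum_(i <- r) dotp u (F i).
Proof. exact: (big_morph _ (dotpDr u) (dotp0r u)). Qed.

Lemma dotp_gt0 u : u != 0 -> 0 < dotp u u.
Proof.
move=> /rV0Pn[i nui]; rewrite /dotp (bigD1 i) //=.
apply: ltr_wpDr; last by rewrite -expr2 exprn_even_gt0.
by apply: sumr_ge0 => j _; rewrite -expr2 sqr_ge0.
Qed.

End Dotp.

(** * Affine hulls, their directions and dimension *)

Section AffineHull.
Context (R : realType) (n : nat).
Implicit Types (A : set 'rV[R]_n) (U W : {vspace 'rV[R]_n}) (x y : 'rV[R]_n).

Lemma affine_hull_self A x : A x -> affine_hull A x.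
Proof.
move=> Ax; exists 1%N, (fun=> x), (fun=> 1).
by split=> //; rewrite big_ord1 ?scale1r.
Qed.

Lemma affine_hull_dotp A a b x : affine_hull A x ->
  (forall p, A p -> dotp a p = b) -> dotp a x = b.
Proof.
case=> m [p [w [Ap w1 ->]]] Ab; rewrite dotp_sumr -[b]mul1r -w1 mulr_suml.
by apply: eq_bigr => i _; rewrite dotpZr Ab.
Qed.

(** U is spanned by the differences p - x for a finite list of points of A, chosen with maximal
    span, so that no further point enlarges it. The minimality clause allows comparison with other
    subspaces without recomputing U. *)
Lemma affine_hull_direction A x : A x -> exists U,
  affine_hull A = [set x + u | u in [set` U]] /\
  forall W, (forall p, A p -> p - x \in W) -> (U <= W)%VS.
Proof.
move=> Ax; pose D (t : seq 'rV[R]_n) := <<[seq p - x | p <- t]>>%VS.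
pose Q k := `[< exists2 t, (forall p, p \in t -> A p) & \dim (D t) = k >].
have exQ : exists k, Q k by exists (\dim (D [::])); apply/asboolP; exists [::].
have ubQ k : Q k -> (k <= n)%N.
  move=> /asboolP[t _ <-]; apply: leq_trans (dimvS (subvf _)) _.
  by rewrite dimvf dim_matrix mul1r.
case: (ex_maxnP exQ ubQ) => k /asboolP[t At dt] kmax.
have AD p : A p -> p - x \in D t.
  move=> Ap; have sD : (D t <= D (p :: t))%VS by rewrite /D /= span_cons addvSr.
  have /eqP -> : D t == D (p :: t).
    rewrite eqEdim sD dt kmax //; apply/asboolP; exists (p :: t) => // q.
    by rewrite inE => /predU1P[->//|/At].
  by apply/memv_span/(map_f (fun q => q - x))/mem_head.
exists (D t); split=> [|W AW]; last first.
  by apply/span_subvP => _ /mapP[p pt ->]; apply/AW/At.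
apply/seteqP; split=> y /=.
  case=> m [p [w [Ap w1 ->]]]; exists (\sum_(i < m) w i *: (p i - x)) => /=.
    by apply: memv_suml => i _; apply/memvZ/AD.
  under eq_bigr do rewrite scalerBr.
  by rewrite sumrB -scaler_suml w1 scale1r addrC subrK.
case=> u uD <-; pose X := map_tuple (fun p => p - x) (in_tuple t).
pose k' i := coord X i u.
have eu : u = \sum_(i < size t) k' i *: (t`_i - x).
  rewrite {1}(@coord_span _ _ _ X u uD).
  by apply: eq_bigr => i _; rewrite (nth_map 0).
(* Slot [ord0] carries the base point x, with the weight that completes the sum to 1. *)
exists (size t).+1, (fun i => if unlift ord0 i is Some j then t`_j else x),
  (fun i => if unlift ord0 i is Some j then k' j else 1 - \sum_j k' j).
split=> [i||].
- by case: unliftP => [j _|//]; apply/At/mem_nth.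
- rewrite big_ord_recl unlift_none -[RHS](subrK (\sum_j k' j)).
  by congr (_ + _); apply: eq_bigr => i _; rewrite liftK.
- rewrite big_ord_recl unlift_none.
  transitivity ((1 - \sum_j k' j) *: x + \sum_i k' i *: t`_i).
    rewrite {1}eu; under [X in x + X]eq_bigr do rewrite scalerBr.
    by rewrite sumrB -scaler_suml scalerBl scale1r addrAC addrA.
  by congr (_ + _); apply: eq_bigr => i _; rewrite liftK.
Qed.

(** [has_dim] provides some base point; this moves it to a chosen point of A, the direction space
    being independent of the base point. *)
Lemma has_dim_direction A k x : A x -> has_dim A k -> exists U,
  [/\ \dim U = k, affine_hull A = [set x + u | u in [set` U]]
    & forall W, (forall p, A p -> p - x \in W) -> (U <= W)%VS].
Proof.
move=> Ax [x0 [U0 [dU0 eA0]]]; have [U [eA minU]] := affine_hull_direction Ax.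
exists U; split=> //; rewrite -dU0; congr (\dim _).
have : affine_hull A x by exact: affine_hull_self.
rewrite eA0 => -[u0 /= u0U0 ex].
apply/vspaceP => u; apply/idP/idP => uU.
  have : affine_hull A (x + u) by rewrite eA; exists u.
  rewrite eA0 => -[u1 /= u1U0]; rewrite -ex -addrA => /addrI eu1.
  by rewrite -(addKr u0 u) -eu1 memvD // memvN.
have : affine_hull A (x0 + (u0 + u)) by rewrite eA0; exists (u0 + u) => //=; rewrite memvD.
by rewrite eA addrA ex => -[u1 /= u1U /addrI <-].
Qed.

Lemma direction_mem A x p U : A x -> A p ->
  affine_hull A = [set x + u | u in [set` U]] -> p - x \in U.
Proof.
move=> Ax Ap eA; have := affine_hull_self Ap; rewrite eA => -[u /= uU <-].
by rewrite addrC addKr.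
Qed.

Lemma has_dim_exists A x : A x -> exists k, has_dim A k.
Proof.
by move=> Ax; have [U [eA _]] := affine_hull_direction Ax; exists (\dim U), x, U.
Qed.

Lemma has_dim_line A x y : A x -> A y -> y != x ->
  (forall z, A z -> exists k, z - x = k *: (y - x)) -> has_dim A 1.
Proof.
move=> Ax Ay nyx line; have [U [eA minU]] := affine_hull_direction Ax.
exists x, U; split=> //.
have d1 : \dim <[y - x]>%VS = 1%N by rewrite dim_vline subr_eq0 nyx.
transitivity (\dim <[y - x]>%VS) => //; congr (\dim _); apply/eqP.
rewrite eqEsubv -memvE (direction_mem Ax Ay eA) andbT;
by apply: minU => p /line[k ->]; rewrite memvZ // memv_line.
Qed.

End AffineHull.

(** * Maxima and bounds over finite sequences *)

Section FiniteSeq.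
Context (R : realType) (T : eqType).

Lemma seq_argmax (s : seq T) (Q : T -> Prop) (g : T -> R) :
  (exists2 p, p \in s & Q p) ->
  exists p, [/\ p \in s, Q p & forall q, q \in s -> Q q -> g q <= g p].
Proof.
elim: s => [[p]//|x s IH] exQ.
have [exQs|nQs] := pselect (exists2 p, p \in s & Q p); last first.
  have Qx : Q x.
    by case: exQ => p; rewrite inE => /predU1P[->//|ps Qp]; case: nQs; exists p.
  exists x; split; rewrite ?mem_head // => q; rewrite inE => /predU1P[->//|qs Qq].
  by case: nQs; exists q.
have [p [ps Qp pmax]] := IH exQs.
have [[Qx ltpx]|nx] := pselect (Q x /\ g p < g x).
  exists x; split; rewrite ?mem_head // => q; rewrite inE => /predU1P[->//|qs Qq].
  exact: le_trans (pmax q qs Qq) (ltW ltpx).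
exists p; split; rewrite ?inE ?ps ?orbT // => q.
rewrite inE => /predU1P[-> Qx|]; last exact: pmax.
by rewrite leNgt; apply/negP => ?; apply: nx.
Qed.

(** Serves to perturb a functional: with [f] its slack at the generators, a large multiple of it
    outweighs any other functional wherever the slack is positive. *)
Lemma seq_dominate (s : seq T) (f g : T -> R) :
  exists N, forall p, p \in s -> 0 < f p -> g p < N * f p.
Proof.
elim: s => [|x s [N IH]]; first by exists 0.
exists (Num.max N (`|g x| / f x + 1)) => p; rewrite inE => /predU1P[->|ps] fp.
  apply: (@lt_le_trans _ _ ((`|g x| / f x + 1) * f x)).
    rewrite mulrDl mul1r divfK ?gt_eqF //.
    by apply: le_lt_trans (ler_norm _) _; rewrite ltrDl.
  by rewrite ler_pM2r // le_max lexx orbT.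
by apply: lt_le_trans (IH p ps fp) _; rewrite ler_pM2r // le_max lexx.
Qed.

Lemma count_asbool_lt (s : seq T) (A B : set T) p : A `<=` B ->
  p \in s -> B p -> ~ A p ->
  (count (fun x => `[< A x >]) s < count (fun x => `[< B x >]) s)%N.
Proof.
move=> sAB; elim: s => // x s IH; rewrite inE => /predU1P[<-|ps] Bp nAp /=.
  rewrite asboolF // asboolT //= ltnS.
  by apply: sub_count => z /asboolP/sAB/asboolP.
have := IH ps Bp nAp; case: (asboolP (A x)) => [/sAB Bx|_ /=].
  by rewrite (asboolT Bx) !add1n ltnS.
by rewrite add0n => /leq_trans; apply; exact: leq_addl.
Qed.

End FiniteSeq.

(** * Sign patterns of coefficients *)

Lemma opposite_signs (R : realFieldType) (p q A B : R) : A < 0 -> B < 0 ->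
  p * A + q * B = 0 -> (p = 0 /\ q = 0) \/ p * q < 0.
Proof.
move=> A0 B0 e; have [p0|p0|p0] := ltgtP p 0.
- have pA : 0 < p * A by nra.
  have q0 : 0 < q by rewrite ltNge; apply/negP => ?; nra.
  by right; nra.
- have pA : p * A < 0 by nra.
  have q0 : q < 0 by rewrite ltNge; apply/negP => ?; nra.
  by right; nra.
- left; split=> //; move/eqP: e; rewrite p0 mul0r add0r mulf_eq0.
  by rewrite (lt_eqF B0) orbF => /eqP.
Qed.

(** Each equation makes its two unknowns both zero or of opposite signs, and three reals cannot have
    pairwise opposite signs. *)
Lemma opposite_signs3 (R : realFieldType) (p q r a12 a13 a21 a23 a31 a32 : R) :
  a12 < 0 -> a13 < 0 -> a21 < 0 -> a23 < 0 -> a31 < 0 -> a32 < 0 ->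
  q * a12 + r * a13 = 0 -> p * a21 + r * a23 = 0 -> p * a31 + q * a32 = 0 ->
  [/\ p = 0, q = 0 & r = 0].
Proof.
move=> l12 l13 l21 l23 l31 l32 /(opposite_signs l12 l13) c1.
move=> /(opposite_signs l21 l23) c2 /(opposite_signs l31 l32) c3.
have neg : q * r < 0 -> p * r < 0 -> p * q < 0 -> False.
  move=> qr pr pq; have : 0 < (q * r) * (p * r) by rewrite nmulr_lgt0.
  by rewrite mulrACA (mulrC q p) ltNge -expr2 mulr_le0_ge0 ?sqr_ge0 // ltW.
case: c1 c2 c3 => [[-> ->]|qr] [[-> r0]|pr] [[p0 q0]|pq] //; exfalso.
all: by subst; nra.
Qed.

(** * Faces, vertices and ascending edges of a polytope *)

Section Polytopes.
Context (R : realType) (n : nat).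
Implicit Types (A F V : set 'rV[R]_n) (a c x y : 'rV[R]_n).

Lemma convex_hull_self V x : V x -> convex_hull V x.
Proof.
move=> Vx; exists 1%N, (fun=> x), (fun=> 1).
by split=> //; rewrite big_ord1 ?scale1r.
Qed.

Lemma convex_hull_nonempty V x : convex_hull V x -> exists y, V y.
Proof.
case=> -[|m] [p [w [Vp _ w1 _]]]; last by exists (p ord0).
by move: w1; rewrite big_ord0 => /eqP; rewrite eq_sym oner_eq0.
Qed.

Lemma convex_hull_le V a b x : convex_hull V x ->
  (forall p, V p -> dotp a p <= b) -> dotp a x <= b.
Proof.
case=> m [p [w [Vp w0 w1 ->]]] Vb.
rewrite dotp_sumr -[b]mul1r -w1 mulr_suml.
by apply: ler_sum => i _; rewrite dotpZr ler_wpM2l // Vb.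
Qed.

(** The slack at x is the weighted sum of the nonnegative slacks of the generators, so every
    generator with nonzero weight has slack zero. *)
Lemma convex_hull_eq V a b x : convex_hull V x ->
  (forall p, V p -> dotp a p <= b) -> dotp a x = b ->
  convex_hull [set p | V p /\ dotp a p = b] x.
Proof.
case=> m [p [w [Vp w0 w1 ->]]] Vb.
move=> eab; have /eqP := eab.
rewrite dotp_sumr -subr_eq0 -oppr_eq0 opprB -{1}[b]mul1r -w1 mulr_suml -sumrB.
rewrite psumr_eq0 => [/allP eb|i _]; last first.
  by rewrite dotpZr subr_ge0 ler_wpM2l // Vb.
have {}eb i : w i != 0 -> dotp a (p i) = b.
  move=> wi; have := eb i (mem_index_enum _); rewrite dotpZr -mulrBr mulf_eq0.
  by rewrite (negPf wi) subr_eq0 => /eqP.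
have [j wj] : exists j, w j != 0.
  apply: contrapT => nw; have : \sum_(i < m) w i = 0.
    by apply: big1 => i _; apply/eqP; apply: contrapT => /negP wi; apply: nw; exists i.
  by rewrite w1 => /eqP; rewrite oner_eq0.
(* Generators of weight zero may have positive slack; they are replaced by [p j], which has nonzero
   weight. *)
exists m, (fun i => if w i == 0 then p j else p i), w; split=> //.
  by move=> i; case: ifPn => [_|wi]; split=> //; apply: eb.
by apply: eq_bigr => i _; case: eqP => // ->; rewrite !scale0r.
Qed.

Context (s : seq 'rV[R]_n).
Let P := convex_hull [set` s].

Lemma face_sub F : face P F -> F `<=` P.
Proof. by case=> a [b [_ ->]] x []. Qed.

Lemma face_hull F x : face P F -> F x ->
  convex_hull [set p | p \in s /\ F p] x.
Proof.
case=> a [b [vab ->]] [Px axb].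
have [|||m [p [w [Vp w0 w1 ->]]]] := @convex_hull_eq [set` s] a b x => //.
  by move=> p sp; apply/vab/convex_hull_self.
exists m, p, w; split=> // i; have [sp ab] := Vp i; do ![split=> //].
exact: convex_hull_self.
Qed.

Lemma face_argmax F a x : face P F -> F x ->
  exists p, [/\ p \in s, F p & forall y, F y -> dotp a y <= dotp a p].
Proof.
move=> fF Fx; have [p0 [sp0 Fp0]] := convex_hull_nonempty (face_hull fF Fx).
have [|p [sp Fp pmax]] := @seq_argmax R _ s F (dotp a); first by exists p0.
exists p; split=> // y Fy; apply: (convex_hull_le (face_hull fF Fy)).
by move=> q [] sq Fq; apply: pmax.
Qed.

Lemma face_const F a b : face P F ->
  (forall p, p \in s -> F p -> dotp a p = b) -> forall x, F x -> dotp a x = b.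
Proof.
move=> fF hs x Fx; apply/eqP; rewrite eq_le.
rewrite (convex_hull_le (face_hull fF Fx)) /=; last first.
  by move=> p [sp Fp]; rewrite hs.
rewrite -lerN2 -dotpNl (convex_hull_le (face_hull fF Fx)) //.
by move=> p [sp Fp]; rewrite dotpNl hs.
Qed.

(** A face of a face is a face: add to [a] a multiple N of the functional of F so large that every
    generator outside F falls strictly below the new bound. *)
Lemma subface F a m : face P F -> (forall x, F x -> dotp a x <= m) ->
  face P [set x | F x /\ dotp a x = m].
Proof.
case=> a0 [b0 [v0 eF]] Fm.
have [N hN] := seq_dominate s (fun p => b0 - dotp a0 p) (fun p => dotp a p - m).
have sP p : p \in s -> P p by exact: convex_hull_self.
have lts p : p \in s -> dotp a0 p <> b0 ->
    dotp (N *: a0 + a) p < N * b0 + m.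
  move=> sp ne; rewrite dotpDl dotpZl.
  have := hN p sp; rewrite subr_gt0 lt_neqAle v0 ?andbT; last exact: sP.
  by move=> /(_ (introN eqP ne)); rewrite mulrBr; lra.
have les p : p \in s -> dotp (N *: a0 + a) p <= N * b0 + m.
  move=> sp; have [e|ne] := pselect (dotp a0 p = b0); last exact/ltW/lts.
  rewrite dotpDl dotpZl e lerD2l Fm // eF; split=> //; exact: sP.
exists (N *: a0 + a), (N * b0 + m); split=> [x Px|]; first exact: convex_hull_le les.
apply/seteqP; split=> x /=.
  by move=> [+ <-]; rewrite eF => -[Px <-]; rewrite dotpDl dotpZl.
case=> Px ex; have hx := convex_hull_eq Px les ex.
have e0 : dotp a0 x = b0.
  apply/eqP; rewrite eq_le v0 //= -lerN2 -dotpNl (convex_hull_le hx) //.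
  move=> p [sp ep]; rewrite dotpNl lerN2.
  have [->//|/(lts p sp)] := pselect (dotp a0 p = b0).
  by rewrite ep ltxx.
have Fx : F x by rewrite eF.
by split=> //; move: ex; rewrite dotpDl dotpZl e0 => /addrI.
Qed.

(** Strong induction on the number of generators in the face; the lost generator p witnesses the
    decrease. *)
Lemma face_ind (Q : set 'rV[R]_n -> Prop) :
  (forall F, face P F ->
    (forall F' p, face P F' -> F' `<=` F -> p \in s -> F p -> ~ F' p -> Q F') ->
    Q F) ->
  forall F, face P F -> Q F.
Proof.
move=> IH F; have [m] := ubnP (count (fun x => `[< F x >]) s).
elim: m F => // m IHm F; rewrite ltnS => lem fF; apply: IH => // F' p fF' sF sp Fp nFp.
by apply: IHm => //; apply: leq_trans lem; apply: count_asbool_lt sF sp Fp nFp.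
Qed.

(** If F has two points x and y, maximizing the direction y - x over F cuts out a smaller nonempty
    face, as this functional separates x from y. *)
Lemma face_vertex F x : face P F -> F x -> exists2 v, vertex P v & F v.
Proof.
move=> fF; elim/face_ind: fF x => {}F fF IH x Fx.
have [F1|/existsNP[y /not_implyP[Fy nxy]]] := pselect (forall y, F y -> y = x).
  exists x => //; rewrite /vertex /=; suff <- : F = [set x] by [].
  by apply/seteqP; split=> y; [exact: F1|move=> ->].
have [p [sp Fp pmax]] := face_argmax (y - x) fF Fx.
pose F' := [set z | F z /\ dotp (y - x) z = dotp (y - x) p].
have fF' : face P F' by exact: subface.
have [hc|/existsNP[q /not_implyP[sq /not_implyP[Fq nq]]]] :=
    pselect (forall q, q \in s -> F q -> dotp (y - x) q = dotp (y - x) p).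
  have := dotp_gt0 (introN eqP (fun e => nxy (subr0_eq e))).
  by rewrite dotpBr !(face_const fF hc) // subrr ltxx.
have sF' : F' `<=` F by move=> z [].
have nF'q : ~ F' q by case.
have [v vv [Fv _]] := IH F' q fF' sF' sq Fq nF'q p (conj Fp erefl).
by exists v.
Qed.

(** Take a functional maximized only at v and tilt it towards c until v is about to lose optimality
    on F. The optimal face at that moment contains v and a costlier generator; it is a proper face
    of F unless F is already an edge, so induction applies. *)
Lemma ascent_edge F c v y : vertex P v -> face P F -> F v -> F y ->
  dotp c v < dotp c y ->
  exists E, [/\ edge P E, E `<=` F, E v & exists2 z, E z & dotp c v < dotp c z].
Proof.
move=> [a [b [va ev]]] fF; elim/face_ind: fF y => {}F fF IH y Fv Fy lt_vy.
have Pv : P v by have : [set v] v by []; rewrite ev => -[].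
have av : dotp a v = b by have : [set v] v by []; rewrite ev => -[].
have lta p : p \in s -> p != v -> dotp a p < b.
  move=> sp /eqP npv; have Pp : P p by exact: convex_hull_self.
  rewrite lt_neqAle va // andbT; apply/eqP => e; apply: npv.
  by have : [set v] p by rewrite ev.
set d := y - v.
have cd0 : 0 < dotp c d by rewrite dotpBr subr_gt0.
have [line|/existsNP[x /not_implyP[Fx nx]]] :=
    pselect (forall z, F z -> exists k, z - v = k *: d).
  exists F; split=> //; last by exists y.
  split=> //; apply: (has_dim_line Fv Fy) => //.
  by apply/eqP => eyv; rewrite eyv ltxx in lt_vy.
(* A direction of F on which c vanishes; it is nonzero because x - v is not a multiple of d. *)
pose e := (x - v) - (dotp c (x - v) / dotp c d) *: d.
have e0 : e != 0.
  by apply/eqP => /subr0_eq exv; apply: nx; exists (dotp c (x - v) / dotp c d).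
have ce : dotp c e = 0 by rewrite dotpBr dotpZr divfK ?subrr ?gt_eqF.
(* The supporting functional at v must also be nonconstant along [e], so that the tilted one cannot
   be constant on F. If [a] vanishes on [e], a large multiple of [a] plus [e] itself does it. *)
have [a' [lta' a'e]] : exists a', (forall p, p \in s -> p != v -> dotp a' p < dotp a' v)
    /\ dotp a' e != 0.
  have [ae|ae] := eqVneq (dotp a e) 0; last first.
    by exists a; split=> // p sp npv; rewrite av lta.
  have [N hN] := seq_dominate s (fun p => b - dotp a p) (fun p => dotp e p - dotp e v).
  exists (N *: a + e); split=> [p sp npv|].
    have := hN p sp; rewrite subr_gt0 lta // => /(_ isT).
    by rewrite !dotpDl !dotpZl av mulrBr; lra.
  by rewrite dotpDl dotpZl ae mulr0 add0r gt_eqF // dotp_gt0.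
have [y' [sy' Fy' y'max]] := face_argmax c fF Fy.
have lt_vy' : dotp c v < dotp c y' := lt_le_trans lt_vy (y'max y Fy).
have ne_v p : dotp c v < dotp c p -> p != v.
  by move=> lt; apply/eqP => epv; rewrite epv ltxx in lt.
(* Gain in cost per loss in a': the generator with the largest ratio is the first to tie with v. *)
pose r p := (dotp c p - dotp c v) / (dotp a' v - dotp a' p).
have [|p [sp [Fp npv] pmax]] := @seq_argmax R _ s (fun p => F p /\ p != v) r.
  by exists y' => //; split=> //; exact: ne_v.
have rp0 : 0 < r p.
  apply: lt_le_trans (pmax y' sy' (conj Fy' (ne_v _ lt_vy'))).
  by rewrite divr_gt0 ?subr_gt0 // lta' // ne_v.
have lt_vp : dotp c v < dotp c p.
  move: rp0; rewrite /r pmulr_lgt0 ?subr_gt0 //.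
  by rewrite invr_gt0 subr_gt0 lta'.
(* v stops being optimal for a' + t c exactly at t = 1 / r p. *)
pose g := c + r p *: a'.
have gmax q : q \in s -> F q -> dotp g q <= dotp g v.
  move=> sq Fq; have [->//|nqv] := eqVneq q v.
  have := pmax q sq (conj Fq nqv).
  rewrite {1}/r ler_pdivrMr ?subr_gt0 ?lta' // !dotpDl !dotpZl mulrBr; lra.
have gp : dotp g p = dotp g v.
  have : r p * (dotp a' v - dotp a' p) = dotp c p - dotp c v.
    by rewrite divfK // subr_eq0 gt_eqF // lta'.
  by rewrite !dotpDl !dotpZl mulrBr; lra.
pose F' := [set z | F z /\ dotp g z = dotp g v].
have fF' : face P F'.
  apply: subface => // z Fz; apply: (convex_hull_le (face_hull fF Fz)).
  by move=> q [sq Fq]; exact: gmax.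
have sF' : F' `<=` F by move=> z [].
(* If g were constant on F, it would vanish on [e], where its value is [r p] times the nonzero value
   of a'. *)
have [hc|/existsNP[q /not_implyP[sq /not_implyP[Fq nq]]]] :=
    pselect (forall q, q \in s -> F q -> dotp g q = dotp g v).
  have : dotp g e = 0.
    by rewrite !(dotpBr, dotpZr) !(face_const fF hc) // !subrr mulr0 subrr.
  rewrite dotpDl dotpZl ce add0r => /eqP; rewrite mulf_eq0 (negPf a'e) orbF.
  by rewrite gt_eqF.
have nF'q : ~ F' q by case.
have [E [eE sE Ev Ez]] :=
  IH F' q fF' sF' sq Fq nF'q p (conj Fv erefl) (conj Fp gp) lt_vp.
by exists E; split=> // z /sE/sF'.
Qed.

(** The head of the arc is a vertex of the face of the ascending edge on which c is largest. *)
Lemma ascent_arc F c v y : vertex P v -> face P F -> F v -> F y ->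
  dotp c v < dotp c y -> exists2 z, F z & skeleton_arc P c v z.
Proof.
move=> vv fF Fv Fy lt_vy.
have [E [eE sE Ev [z Ez lt_vz]]] := ascent_edge vv fF Fv Fy lt_vy.
have [fE _] := eE.
have [p [_ Ep pmax]] := face_argmax c fE Ez.
have [w vw [Ew ew]] := face_vertex (subface fE pmax) (conj Ep erefl).
exists w; first exact: sE.
split=> //; first by exists E.
by rewrite ew; apply: lt_le_trans lt_vz (pmax z Ez).
Qed.

Lemma vertex_mid v x y t : vertex P v -> P x -> P y -> 0 < t -> t < 1 ->
  v = x + t *: (y - x) -> x = v.
Proof.
move=> [a [b [va ev]]] Px Py t0 t1 e.
have av : dotp a v = b by have : [set v] v by []; rewrite ev => -[].
have ax := va x Px; have ay := va y Py.
suff : [set v] x by [].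
rewrite ev; split=> //; apply/eqP; rewrite eq_le ax leNgt /=; apply/negP => ltx.
have h1 : 0 < (1 - t) * (b - dotp a x) by rewrite mulr_gt0 ?subr_gt0.
have h2 : 0 <= t * (b - dotp a y) by rewrite mulr_ge0 ?subr_ge0 // ltW.
by move: av; rewrite e dotpDr dotpZr dotpBr; lra.
Qed.

(** The equation that cuts F out of P persists on the affine hull of F. *)
Lemma face_affine F x : face P F -> P x -> affine_hull F x -> F x.
Proof.
case=> a [b [_ ->]] Px hx; split=> //.
by apply: affine_hull_dotp hx _ => p [].
Qed.

Lemma edge_line E x y z : edge P E -> E x -> E y -> E z -> x != y ->
  exists k, z - x = k *: (y - x).
Proof.
move=> [_ dE] Ex Ey Ez nxy.
have [U [dU eU _]] := has_dim_direction Ex dE.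
have UE p : E p -> p - x \in U by move=> Ep; apply: direction_mem Ex Ep eU.
apply/vlineP; suff -> : <[y - x]>%VS = U by exact: UE.
apply/eqP; rewrite eqEdim -memvE UE // dU dim_vline subr_eq0 eq_sym.
by rewrite nxy.
Qed.

(** * Edges and 2-faces under a generic cost *)

Section Generic.
Context (c : 'rV[R]_n).
Hypothesis genc : generic P c.

(** Cost is affine along the line of E, so v would lie strictly inside the segment from u to w,
    which [vertex_mid] excludes. *)
Lemma no_vertex_between E u v w : edge P E -> vertex P v ->
  E u -> E v -> E w -> dotp c u < dotp c v -> dotp c v < dotp c w -> False.
Proof.
move=> eE vv Eu Ev Ew ltuv ltvw; have [fE _] := eE.
have nuw : u != w by apply/eqP => e; rewrite e (lt_gtF ltvw) in ltuv.
have [k ek] := edge_line eE Eu Ew Ev nuw.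
have ck : dotp c v - dotp c u = k * (dotp c w - dotp c u).
  by rewrite -!dotpBr ek dotpZr.
have euv : u = v.
  have D0 : 0 < dotp c w - dotp c u by rewrite subr_gt0 (lt_trans ltuv).
  apply: (@vertex_mid v u w k) => //.
  - exact: face_sub Eu.
  - exact: face_sub Ew.
  - by rewrite -(pmulr_lgt0 k D0) -ck subr_gt0.
  - by rewrite -(ltr_pM2r D0) -ck mul1r; lra.
  - by rewrite -ek addrC subrK.
by rewrite euv ltxx in ltuv.
Qed.

(** Genericity orders the costs of three distinct vertices strictly, and the middle one would lie
    between the others on the edge. *)
Lemma edge_vertices E u v w : edge P E -> vertex P u -> vertex P v ->
  vertex P w -> E u -> E v -> E w -> u <> v -> u <> w -> v = w.
Proof.
move=> eE vu vv vw Eu Ev Ew nuv nuw; apply: contrapT => nvw.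
have := no_vertex_between eE vu Ev Eu Ew; have := no_vertex_between eE vu Ew Eu Ev.
have := no_vertex_between eE vv Eu Ev Ew; have := no_vertex_between eE vv Ew Ev Eu.
have := no_vertex_between eE vw Eu Ew Ev; have := no_vertex_between eE vw Ev Ew Eu.
have /eqP := genc vu vv nuv; have /eqP := genc vu vw nuw; have /eqP := genc vv vw nvw.
by rewrite !neq_lt => /orP[] ? /orP[] ? /orP[] ?; tauto.
Qed.

Lemma edge_functional E w x : edge P E -> E w -> E x -> exists a,
  dotp a (x - w) = 0 /\ forall y, P y -> ~ E y -> dotp a (y - w) < 0.
Proof.
move=> [[a [b [va eE]]] _]; rewrite eE => -[Pw aw] [Px ax].
exists a; split=> [|y Py nEy]; first by rewrite dotpBr ax aw subrr.
rewrite dotpBr subr_lt0 aw lt_neqAle va // andbT; apply/eqP => ay.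
by apply: nEy.
Qed.

(* Each edge at w is supported by a functional that is negative on the other
   two edge directions; in a plane the three directions are dependent, and the
   coefficients would have pairwise opposite signs. *)
Lemma polygon_degree F w x1 x2 x3 E1 E2 E3 : face P F -> has_dim F 2 ->
  vertex P w -> vertex P x1 -> vertex P x2 -> vertex P x3 ->
  F w -> F x1 -> F x2 -> F x3 ->
  edge P E1 -> edge P E2 -> edge P E3 -> E1 w -> E2 w -> E3 w ->
  E1 x1 -> E2 x2 -> E3 x3 -> x1 <> w -> x2 <> w -> x3 <> w ->
  x1 <> x2 -> x1 <> x3 -> x2 <> x3 -> False.
Proof.
move=> fF dF vw v1 v2 v3 Fw F1 F2 F3 e1 e2 e3 E1w E2w E3w E1x E2x E3x
  n1 n2 n3 n12 n13 n23.
have [U [dU eU _]] := has_dim_direction Fw dF.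
have UF p : F p -> p - w \in U by move=> Fp; apply: direction_mem Fw Fp eU.
have FP := face_sub fF.
(* An edge at w has only one other vertex, so each of the three edges misses the neighbours along
   the other two. *)
have sep E x y : edge P E -> E w -> E x -> vertex P x -> vertex P y ->
    x <> w -> y <> w -> x <> y -> ~ E y.
  move=> eE Ew Ex vx vy nx ny nxy Ey.
  by apply: nxy; apply: (edge_vertices eE vw vx vy Ew Ex Ey) => /esym.
have [a1 [a11 a1lt]] := edge_functional e1 E1w E1x.
have [a2 [a22 a2lt]] := edge_functional e2 E2w E2x.
have [a3 [a33 a3lt]] := edge_functional e3 E3w E3x.
have a12 := a1lt _ (FP _ F2) (sep _ _ _ e1 E1w E1x v1 v2 n1 n2 n12).
have a13 := a1lt _ (FP _ F3) (sep _ _ _ e1 E1w E1x v1 v3 n1 n3 n13).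
have a21 := a2lt _ (FP _ F1) (sep _ _ _ e2 E2w E2x v2 v1 n2 n1 (nesym n12)).
have a23 := a2lt _ (FP _ F3) (sep _ _ _ e2 E2w E2x v2 v3 n2 n3 n23).
have a31 := a3lt _ (FP _ F1) (sep _ _ _ e3 E3w E3x v3 v1 n3 n1 (nesym n13)).
have a32 := a3lt _ (FP _ F2) (sep _ _ _ e3 E3w E3x v3 v2 n3 n2 (nesym n23)).
pose D := [tuple x1 - w; x2 - w; x3 - w].
have : ~~ free D.
  apply/negP => /eqP fr.
  have : (\dim <<D>> <= \dim U)%N.
    apply: dimvS; apply/span_subvP => z.
    by rewrite !inE => /or3P[]/eqP ->; exact: UF.
  by rewrite fr dU.
apply/negP; rewrite negbK; apply/freeP => k; rewrite !big_ord_recl big_ord0 /=.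
rewrite addr0.
set k1 := k _; set k2 := k _; set k3 := k _ => dep.
have lin a : k1 * dotp a (x1 - w) +
    (k2 * dotp a (x2 - w) + k3 * dotp a (x3 - w)) = 0.
  by rewrite -!dotpZr -!dotpDr dep dotp0r.
move: (lin a1) (lin a2) (lin a3); rewrite a11 a22 a33 => d1 d2 d3.
have [k10 k20 k30] : [/\ k1 = 0, k2 = 0 & k3 = 0].
  by apply: (opposite_signs3 a12 a13 a21 a23 a31 a32); lra.
move=> [[|[|[|//]]] lti]; [rewrite -k10|rewrite -k20|rewrite -k30];
  by congr k; apply: val_inj.
Qed.

(** The two edges differ, since an edge has a single vertex besides u; simplicity at u with i = 2
    then gives the 2-face. *)
Lemma arcs_polygon u x y : simple_polytope P ->
  skeleton_arc P c u x -> skeleton_arc P c u y -> x <> y ->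
  exists G, [/\ face P G, has_dim G 2 & [/\ G u, G x & G y]].
Proof.
move=> [_ simpleP] [vu vx [E [eE Eu Ex]] ltux] [_ vy [E' [eE' E'u E'y]] ltuy] nxy.
have ne a b : dotp c a < dotp c b -> a <> b by move=> lt e; rewrite e ltxx in lt.
have nE : E' <> E.
  move=> eEE; rewrite eEE in E'u E'y.
  exact: nxy (edge_vertices eE vu vx vy Eu Ex E'y (ne _ _ ltux) (ne _ _ ltuy)).
have [|| G [fG dG Gu sG]] := simpleP u 2%N [set E; E'] vu.
- by move=> _ [->|->].
- apply/eq_cardSP; exists E; first by left.
  rewrite (_ : _ `\ _ = [set E']) ?card_set1 //; apply/seteqP; split=> S /=.
    by case=> -[].
  by move=> ->; split=> //; right.
by exists G; split=> //; split=> //; [apply: (sG E) => //; left|apply: (sG E') => //; right].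
Qed.

(** The plane of F is expressed by u, y and z alone. If u - y and z - y were dependent, the costs
    would put y strictly between u and z, impossible for a vertex. *)
Lemma polygon_affine_hull F u y z : face P F -> has_dim F 2 ->
  F u -> F y -> F z -> vertex P y -> dotp c u < dotp c y -> dotp c y < dotp c z ->
  affine_hull F = [set y + w | w in [set` <<[:: u - y; z - y]>>%VS]].
Proof.
move=> fF dF Fu Fy Fz vy ltuy ltyz.
have [U [dU eU _]] := has_dim_direction Fy dF.
suff -> : <<[:: u - y; z - y]>>%VS = U by [].
apply/eqP; rewrite eqEdim; apply/andP; split.
  by apply/span_subvP => p; rewrite !inE => /orP[]/eqP ->; apply: direction_mem Fy _ eU.
suff /eqP -> : free [:: u - y; z - y] by rewrite dU.
have nzy : z - y != 0.
  by rewrite subr_eq0; apply/eqP => e; rewrite e ltxx in ltyz.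
rewrite free_cons seq1_free nzy andbT span_seq1; apply/negP => /vlineP[k ek].
have ck : dotp c u - dotp c y = k * (dotp c z - dotp c y).
  by rewrite -!dotpBr ek dotpZr.
have k0 : k < 0.
  by rewrite -(@pmulr_llt0 _ (dotp c z - dotp c y)) ?subr_gt0 // -ck subr_lt0.
have k1 : 0 < 1 - k by lra.
(* From u - y = k (z - y) one gets z - u = (1 - k) (z - y), whence the parameter - k / (1 - k) of y
   on the segment from u to z. *)
have euy : u = y.
  apply: (@vertex_mid y u z (- k / (1 - k))) => //.
  - exact: face_sub Fu.
  - exact: face_sub Fz.
  - by rewrite divr_gt0 ?oppr_gt0.
  - by rewrite ltr_pdivrMr // mul1r; lra.
  - rewrite (_ : z - u = (1 - k) *: (z - y)).
      by rewrite scalerA divfK ?gt_eqF // scaleNr -ek opprB addrC subrK.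
    by rewrite scalerBl scale1r -ek opprB addrA subrK.
by rewrite euy ltxx in ltuy.
Qed.

(** By [face_affine] each of the two faces is the intersection of P with the same plane. *)
Lemma polygon_eq F G u y z : face P F -> has_dim F 2 -> face P G -> has_dim G 2 ->
  F u -> F y -> F z -> G u -> G y -> G z ->
  vertex P y -> dotp c u < dotp c y -> dotp c y < dotp c z -> F = G.
Proof.
move=> fF dF fG dG Fu Fy Fz Gu Gy Gz vy ltuy ltyz.
have hF := polygon_affine_hull fF dF Fu Fy Fz vy ltuy ltyz.
have hG := polygon_affine_hull fG dG Gu Gy Gz vy ltuy ltyz.
apply/seteqP; split=> p Hp.
  apply: (face_affine fG); first exact: face_sub Hp.
  by rewrite hG -hF; apply: affine_hull_self.
apply: (face_affine fF); first exact: face_sub Hp.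
by rewrite hF -hG; apply: affine_hull_self.
Qed.

(** A face of dimension at least 3 has the same affine hull as P, hence contains P by
    [face_affine]. *)
Lemma face_lt3_or_full F x : has_dim P 3 -> face P F -> F x ->
  (exists2 k, (k < 3)%N & has_dim F k) \/ F = P.
Proof.
move=> dP fF Fx; have Px := face_sub fF Fx.
have [k dF] := has_dim_exists Fx.
have [U [dU eU minU]] := has_dim_direction Fx dF.
have [W [dW eW _]] := has_dim_direction Px dP.
have sUW : (U <= W)%VS.
  by apply: minU => p /(face_sub fF) Pp; apply: direction_mem Px Pp eW.
have := ltnP k 3; case=> [lt|le3]; [by left; exists k|right].
have eUW : U = W by apply/eqP; rewrite eqEdim sUW dU dW.
apply/seteqP; split=> [|p Pp]; first exact: face_sub.
apply: (face_affine fF) => //; rewrite eU eUW -eW.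
exact: affine_hull_self.
Qed.

End Generic.

End Polytopes.

(** * Transfer between the polytope and the lattice *)

Theorem theorem5p1 (R : realType) (n : nat) (P : set 'rV[R]_n) (c : 'rV[R]_n)
    (d : Order.disp_t) (L : finLatticeType d) :
  simple_polytope P -> has_dim P 3 -> generic P c ->
  is_hasse_diagram (vertex P) (skeleton_arc P c) L ->
  nonrevisiting P c.
Proof.
move=> sP dP genc [f [[fV finj fsurj] fA]].
have [[V /finite_seqP[s ->] eP] _] := sP; rewrite eP in sP dP genc fV fsurj fA *.
set Q := convex_hull _ in sP dP genc fV fsurj fA *.
have vf x : vertex Q (f x) by apply: fV.
have f_inj x y : f x = f y -> x = y by apply: finj; rewrite in_setT.
have arc_cost x y : covered_by x y -> dotp c (f x) < dotp c (f y).
  by move=> /fA[].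
pose polygon (A : set L) :=
  exists F, [/\ face Q F, has_dim F 2 & A = f @^-1` F].
have C_inj : injective (fun x => dotp c (f x)).
  move=> x y e; apply: f_inj; apply: contrapT => nxy.
  exact: genc (vf x) (vf y) nxy e.
have up F x y : face Q F -> F (f x) -> F (f y) -> dotp c (f x) < dotp c (f y) ->
    exists2 z, F (f z) & covered_by x z.
  move=> fF Fx Fy ltxy; have [w Fw xw] := ascent_arc (vf x) fF Fx Fy ltxy.
  have [_ vw _ _] := xw; have [z _ ez] := fsurj w vw.
  by exists z; [rewrite ez|apply/fA; rewrite ez].
have deg (A : set L) w p q r : polygon A -> A w -> A p -> A q -> A r ->
    covered_by p w -> covered_by q w -> covered_by w r -> p = q.
  move=> [F [fF dF ->]] Fw Fp Fq Fr pw qw wr; apply: contrapT => npq.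
  have [_ _ [E1 [e1 E1p E1w]] ltpw] := (fA _ _).2 pw.
  have [_ _ [E2 [e2 E2q E2w]] ltqw] := (fA _ _).2 qw.
  have [_ _ [E3 [e3 E3w E3r]] ltwr] := (fA _ _).2 wr.
  have ne a b : dotp c a < dotp c b -> a <> b by move=> lt e; rewrite e ltxx in lt.
  apply: (polygon_degree genc fF dF (vf w) (vf p) (vf q) (vf r) Fw Fp Fq Fr
    e1 e2 e3 E1w E2w E3w E1p E2q E3r (ne _ _ ltpw) (ne _ _ ltqw) (nesym (ne _ _ ltwr))).
  - by move=> /f_inj.
  - exact: ne _ _ (lt_trans ltpw ltwr).
  - exact: ne _ _ (lt_trans ltqw ltwr).
have span u x y : covered_by u x -> covered_by u y -> x <> y ->
    exists2 A, polygon A & [/\ A u, A x & A y].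
  move=> /fA ux /fA uy nxy.
  have [|G [fG dG [Gu Gx Gy]]] := arcs_polygon genc sP ux uy.
    by move=> /f_inj.
  by exists (f @^-1` G) => //; exists G.
have cap (A B : set L) u y z : polygon A -> polygon B ->
    A u -> A y -> A z -> B u -> B y -> B z ->
    covered_by u y -> covered_by y z -> A = B.
  move=> [F [fF dF ->]] [G [fG dG ->]] Fu Fy Fz Gu Gy Gz uy yz.
  congr (_ @^-1` _).
  exact: polygon_eq fF dF fG dG Fu Fy Fz Gu Gy Gz (vf y) (arc_cost _ _ uy) (arc_cost _ _ yz).
have polygon_up (A : set L) x y : polygon A -> A x -> A y ->
    dotp c (f x) < dotp c (f y) -> exists2 z, A z & covered_by x z.
  by move=> [F [fF _ ->]]; apply: up.
have convex F u x v : face Q F -> F (f u) -> F (f v) ->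
    (u <= x)%O -> (x <= v)%O -> F (f x).
  move=> fF Fu Fv leux lexv.
  have [euv|nuv] := eqVneq u v.
    by have -> : x = v by apply/le_anti; rewrite lexv -euv leux.
  have ltuv : (u < v)%O by rewrite lt_neqAle nuv (le_trans leux).
  (* The cases come in decreasing dimension: P itself; a 2-face; an edge, where v covers u and
     nothing lies between; a single point, which contradicts u < v. *)
  have [[[|[|[|//]]] _ dF]|->] := face_lt3_or_full dP fF Fu; last first.
  - exact: (face_sub (vf x) erefl).
  - apply: (polygon_convex C_inj arc_cost polygon_up deg span cap
      (F := f @^-1` F) _ Fu Fv leux lexv).
    by exists F.
  - have [_ nuv'] : covered_by u v.
      apply/fA; split=> //; first by exists F.
      exact: (cost_lt (C := fun z => dotp c (f z)) arc_cost ltuv).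
    have [<-//|nux] := eqVneq u x; have [->//|nxv] := eqVneq x v.
    by case: (nuv' x); rewrite !lt_neqAle nux nxv.
  - have [U [dU eU _]] := has_dim_direction Fu dF.
    have := direction_mem Fu Fv eU.
    move/eqP: dU; rewrite dimv_eq0 => /eqP ->; rewrite memv0 subr_eq0 => /eqP.
    by move=> /f_inj e; rewrite e eqxx in nuv.
(* A directed path lifts to a chain of covers in L, so all its vertices lie between its two ends;
   order convexity of the face then finishes the proof. *)
have pathL u s' : path (fun x y => `[< skeleton_arc Q c x y >]) (f u) s' ->
    exists2 t, s' = map f t & forall x, x \in u :: t ->
      (u <= x)%O /\ (x <= last u t)%O.
  elim: s' u => [u _|y s' IH u /= /andP[/asboolP uy]].
    by exists [::] => // x; rewrite inE => /eqP ->.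
  have [_ vy _ _] := uy; have [z _ ez] := fsurj y vy; rewrite -ez in uy * => /IH[t -> ht].
  have [/ltW leuz _] := (fA _ _).1 uy.
  have [_ lezl] := ht z (mem_head _ _).
  exists (z :: t) => // x; rewrite inE => /predU1P[->|/ht[lezx lexl]] /=.
    by split=> //; apply: le_trans lezl.
  by split=> //; apply: le_trans lezx.
(* The empty path is separate: only a first arc guarantees that u is a vertex, hence the image of an
   element of L. *)
move=> F u [|y s'] fF; first by move=> _ Fu _ x; rewrite inE => /eqP ->.
move=> pth Fu; have [vu _ _ _] : skeleton_arc Q c u y.
  by move: pth => /= /andP[/asboolP].
have [u' _ eu] := fsurj u vu; rewrite -eu in pth Fu *.
have [t -> ht] := pathL _ _ pth; rewrite last_map -map_cons => Fl x /mapP[x' x't ->].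
have [leux lexl] := ht x' x't.
exact: convex fF Fu Fl leux lexl.
Qed.
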